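(* Let $\mathcal{H}$ be a commutative finite-dimensional Hopf algebra over a field $\mathbb{K}$ of characteristic zero, let $\mathcal{A}$ be a right $\mathcal{H}$-comodule algebra with coinvariant subalgebra $\mathcal{B}$, let $\sigma:\mathcal{A}\to\mathcal{A}$ be an algebra map and $\delta:\mathcal{A}\to\mathcal{A}$ a $\sigma$-derivation, and assume both $\sigma$ and $\delta$ are morphisms of $\mathcal{H}$-comodules. Let $\mathcal{T}=\mathcal{A}[X,\sigma,\delta]$ and $\mathcal{S}=\mathcal{B}[X,\sigma,\delta]$. (1) The center $\mathcal{Z}$ of $\mathcal{A}$ and $\mathcal{A}^\sigma\cap\mathcal{A}^\delta\cap\mathcal{Z}$ are $\mathcal{H}$-comodule subalgebras of $\mathcal{A}$, and the algebra of coinvariant elements of $\mathcal{A}^\sigma\cap\mathcal{A}^\delta\cap\mathcal{Z}$ is $\mathcal{B}^\sigma\cap\mathcal{B}^\delta\cap\mathcal{Z}$. (2) If $\mathcal{B}^\sigma\cap\mathcal{B}^\delta\cap\mathcal{Z}\subseteq\mathcal{A}^\sigma\cap\mathcal{A}^\delta\cap\mathcal{Z}$ is an $\mathcal{H}$-Galois extension, then $\mathcal{S}\subseteq\mathcal{T}$ is a centrally $\mathcal{H}$-Galois extension.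
   Context: $\mathcal{A}$ is a right $\mathcal{H}$-comodule algebra via an algebra map $\rho(a)=\sum a_{\langle0\rangle}\otimes a_{\langle1\rangle}$; $\mathcal{B}=\{a:\rho(a)=a\otimes1\}$. A $\sigma$-derivation satisfies $\delta(ab)=\sigma(a)\delta(b)+\delta(a)b$. The Ore extension $\mathcal{A}[X,\sigma,\delta]$ is the free left $\mathcal{A}$-module with basis $1,X,X^2,\dots$ and multiplication determined by $X^nX^m=X^{n+m}$ and $Xa=\sigma(a)X+\delta(a)$; since $\sigma,\delta$ preserve $\mathcal{B}$, $\mathcal{B}[X,\sigma,\delta]$ is its subalgebra. $\mathcal{T}$ is an $\mathcal{H}$-comodule algebra via $\rho_{\mathcal{T}}(aX^n)=\sum a_{\langle0\rangle}X^n\otimes a_{\langle1\rangle}$, whose coinvariant subalgebra is $\mathcal{S}$. $\mathcal{A}^\sigma=\{a:\sigma(a)=a\}$, $\mathcal{A}^\delta=\{a:\delta(a)=0\}$, similarly for $\mathcal{B}$. An extension of coinvariants $\mathcal{C}'\subseteq\mathcal{C}$ is $\mathcal{H}$-Galois if $\mathcal{C}\otimes_{\mathcal{C}'}\mathcal{C}\to\mathcal{C}\otimes\mathcal{H}$, $c\otimes x\mapsto\sum cx_{\langle0\rangle}\otimes x_{\langle1\rangle}$, is bijective. An $\mathcal{H}$-comodule algebra $\mathcal{C}$ with coinvariants $\mathcal{C}'$ is centrally $\mathcal{H}$-Galois over $\mathcal{C}'$ if its center $Z(\mathcal{C})$ is a subcomodule and $Z(\mathcal{C})^{\mathrm{co}\mathcal{H}}\subseteq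 Z(\mathcal{C})$ is an $\mathcal{H}$-Galois extension with $Z(\mathcal{C})$ faithfully flat over $Z(\mathcal{C})^{\mathrm{co}\mathcal{H}}$. *)

(* Defs.v *)
From HB Require Import structures.
From mathcomp Require Import all_boot all_order all_algebra.
Set Implicit Arguments. Unset Strict Implicit. Unset Printing Implicit Defensive.
Import GRing.Theory.
Local Open Scope ring_scope.

(* A finite-dimensional Hopf algebra H over K, given by structure constants  *)
(* with respect to a basis e_0, ..., e_(n-1).  An element of H is its        *)
(* coordinate vector 'I_n -> K; an element of H (x) H is 'I_n -> 'I_n -> K.  *)
(*   e_i e_j   = \sum_k hmul i j k e_k                                       *)
(*   1_H       = \sum_k hunit k e_k                                          *)
(*   Delta e_k = \sum_(i,j) hcomul k i j e_i (x) e_j                         *)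
(*   eps e_k   = hcounit k                                                   *)
Record hopf_data (K : fieldType) (n : nat) := HopfData {
  hmul : 'I_n -> 'I_n -> 'I_n -> K;
  hunit : 'I_n -> K;
  hcomul : 'I_n -> 'I_n -> 'I_n -> K;
  hcounit : 'I_n -> K }.

Section HopfDefs.
Variables (K : fieldType) (n : nat) (H : hopf_data K n).

Definition hbasis (i : 'I_n) : 'I_n -> K := fun k => (k == i)%:R.
Definition hprod (x y : 'I_n -> K) : 'I_n -> K :=
  fun k => \sum_i \sum_j x i * y j * hmul H i j k.
Definition hcom (x : 'I_n -> K) : 'I_n -> 'I_n -> K :=
  fun i j => \sum_k x k * hcomul H k i j.
Definition hcoun (x : 'I_n -> K) : K := \sum_k x k * hcounit H k.
Definition tprod (t u : 'I_n -> 'I_n -> K) : 'I_n -> 'I_n -> K :=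
  fun i j => \sum_a \sum_b \sum_c \sum_d
               t a b * u c d * hmul H a c i * hmul H b d j.
Definition hlin (S : 'I_n -> 'I_n -> K) (x : 'I_n -> K) : 'I_n -> K :=
  fun k => \sum_i x i * S i k.

Definition is_hopf : Prop :=
  (forall x y z k, hprod (hprod x y) z k = hprod x (hprod y z) k) /\
  (forall x k, hprod (hunit H) x k = x k /\ hprod x (hunit H) k = x k) /\
  (forall x i j l, \sum_a hcom x a l * hcomul H a i j
                   = \sum_b hcom x i b * hcomul H b j l) /\
  (forall x j, \sum_i hcom x i j * hcounit H i = x j) /\
  (forall x i, \sum_j hcom x i j * hcounit H j = x i) /\
  (forall x y i j, hcom (hprod x y) i j = tprod (hcom x) (hcom y) i j) /\
  (forall i j, hcom (hunit H) i j = hunit H i * hunit H j) /\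
  (forall x y, hcoun (hprod x y) = hcoun x * hcoun y) /\
  (hcoun (hunit H) = 1) /\
  (exists S : 'I_n -> 'I_n -> K, forall x k,
     \sum_i \sum_j hcom x i j * hprod (hlin S (hbasis i)) (hbasis j) k
       = hcoun x * hunit H k /\
     \sum_i \sum_j hcom x i j * hprod (hbasis i) (hlin S (hbasis j)) k
       = hcoun x * hunit H k).

Definition hopf_commutative : Prop := forall x y k, hprod x y k = hprod y x k.

(* Right H-comodule algebras.  A coaction rho : A -> A (x) H is given by its *)
(* components: rho(a) = \sum_i rho i a (x) e_i.                              *)
Section ComoduleAlgebra.
Variables (A : algType K) (rho : 'I_n -> A -> A).

Definition klinear (f : A -> A) : Prop :=
  forall (c : K) (a b : A), f (c *: a + b) = c *: f a + f b.

Definition comodule_algebra : Prop :=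
  (forall i, klinear (rho i)) /\
  (* (rho (x) id) rho = (id (x) Delta) rho *)
  (forall a i j, rho j (rho i a) = \sum_k hcomul H k j i *: rho k a) /\
  (forall a, \sum_i hcounit H i *: rho i a = a) /\
  (forall a b k, rho k (a * b) = \sum_i \sum_j hmul H i j k *: (rho i a * rho j b)) /\
  (forall k, rho k 1 = hunit H k *: 1).

Definition coinv (a : A) : Prop := forall i, rho i a = hunit H i *: a.

Definition comodule_morph (f : A -> A) : Prop :=
  forall i a, rho i (f a) = f (rho i a).

Definition central (a : A) : Prop := forall b : A, a * b = b * a.

Definition subalgebra (P : A -> Prop) : Prop :=
  P 1 /\ (forall a b, P a -> P b -> P (a + b)) /\
  (forall (c : K) a, P a -> P (c *: a)) /\
  (forall a b, P a -> P b -> P (a * b)).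

Definition comodule_subalgebra (P : A -> Prop) : Prop :=
  subalgebra P /\ (forall a i, P a -> P (rho i a)).

Definition alg_map (s : A -> A) : Prop :=
  klinear s /\ (forall a b, s (a * b) = s a * s b) /\ s 1 = 1.

Definition sigma_derivation (s d : A -> A) : Prop :=
  klinear d /\ (forall a b, d (a * b) = s a * d b + d a * b).

End ComoduleAlgebra.

(* Generic notions for an H-comodule algebra carried by V, with             *)
(* multiplication mul, unit one, coaction components rhoV and the K-action  *)
(* sc (used to express x (x) 1_H).                                           *)
Section Generic.
Variables (V : zmodType) (mul : V -> V -> V) (one : V)
          (rhoV : 'I_n -> V -> V) (sc : K -> V -> V).

Definition gcoinv (x : V) : Prop := forall i, rhoV i x = sc (hunit H i) x.
Definition gcentral (x : V) : Prop := forall y, mul x y = mul y x.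

(* tensor product C (x)_{C'} C : finite formal sums (lists of pairs); two   *)
(* formal sums are equal in the tensor product iff they agree under every   *)
(* C'-balanced biadditive map (universal property).                         *)
Definition in_C2 (C : V -> Prop) (s : seq (V * V)) : Prop :=
  forall p, p \in s -> C p.1 /\ C p.2.

Definition balanced (C C' : V -> Prop) (M : zmodType) (f : V -> V -> M) : Prop :=
  (forall c c' x, C c -> C c' -> C x -> f (c + c') x = f c x + f c' x) /\
  (forall c x x', C c -> C x -> C x' -> f c (x + x') = f c x + f c x') /\
  (forall c b x, C c -> C' b -> C x -> f (mul c b) x = f c (mul b x)).

Definition tensor_eq (C C' : V -> Prop) (s t : seq (V * V)) : Prop :=
  forall (M : zmodType) (f : V -> V -> M), balanced C C' f ->
    \sum_(p <- s) f p.1 p.2 = \sum_(p <- t) f p.1 p.2.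

(* Galois map c (x) x |-> \sum c x_<0> (x) x_<1>, an element of C (x) H  *)
(* written by its components along the basis of H.                          *)
Definition galois_map (s : seq (V * V)) (i : 'I_n) : V :=
  \sum_(p <- s) mul p.1 (rhoV i p.2).

Definition galois_ext (C C' : V -> Prop) : Prop :=
  (forall s t, in_C2 C s -> in_C2 C t ->
     (forall i, galois_map s i = galois_map t i) -> tensor_eq C C' s t) /\
  (forall y : 'I_n -> V, (forall i, C (y i)) ->
     exists s, in_C2 C s /\ forall i, galois_map s i = y i).

(* modules over a subring R of V (R given as a predicate, assumed           *)
(* commutative in the uses below) *)
Definition rmod (R : V -> Prop) (M : zmodType) (act : V -> M -> M) : Prop :=
  (forall r m m', R r -> act r (m + m') = act r m + act r m') /\
  (forall r s m, R r -> R s -> act (r + s) m = act r m + act s m) /\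
  (forall r s m, R r -> R s -> act (mul r s) m = act r (act s m)) /\
  (forall m, act one m = m).

Definition rlin (R : V -> Prop) (M1 M2 : zmodType) (a1 : V -> M1 -> M1)
  (a2 : V -> M2 -> M2) (f : M1 -> M2) : Prop :=
  (forall m m', f (m + m') = f m + f m') /\
  (forall r m, R r -> f (a1 r m) = a2 r (f m)).

(* tensor product M (x)_R Z, with Z \subseteq V an R-module by mul *)
Definition in_Z (Z : V -> Prop) (M : zmodType) (s : seq (M * V)) : Prop :=
  forall p, p \in s -> Z p.2.

Definition mbalanced (R Z : V -> Prop) (M : zmodType) (act : V -> M -> M)
  (P : zmodType) (g : M -> V -> P) : Prop :=
  (forall m m' z, Z z -> g (m + m') z = g m z + g m' z) /\
  (forall m z z', Z z -> Z z' -> g m (z + z') = g m z + g m z') /\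
  (forall r m z, R r -> Z z -> g (act r m) z = g m (mul r z)).

Definition mtensor_eq (R Z : V -> Prop) (M : zmodType) (act : V -> M -> M)
  (s t : seq (M * V)) : Prop :=
  forall (P : zmodType) (g : M -> V -> P), mbalanced R Z act g ->
    \sum_(p <- s) g p.1 p.2 = \sum_(p <- t) g p.1 p.2.

(* Z is faithfully flat over R: a sequence M1 -f-> M2 -g-> M3 of R-modules *)
(* is exact iff M1 (x) Z -> M2 (x) Z -> M3 (x) Z is exact.                  *)
Definition faithfully_flat (R Z : V -> Prop) : Prop :=
  forall (M1 M2 M3 : zmodType) (a1 : V -> M1 -> M1) (a2 : V -> M2 -> M2)
         (a3 : V -> M3 -> M3) (f : M1 -> M2) (g : M2 -> M3),
    rmod R a1 -> rmod R a2 -> rmod R a3 -> rlin R a1 a2 f -> rlin R a2 a3 g ->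
    ((forall m, g m = 0 <-> exists m', f m' = m) <->
     (forall s : seq (M2 * V), in_Z Z s ->
        (mtensor_eq R Z a3 [seq (g p.1, p.2) | p <- s] [::] <->
         exists s' : seq (M1 * V), in_Z Z s' /\
            mtensor_eq R Z a2 [seq (f p.1, p.2) | p <- s'] s))).

Definition centrally_galois : Prop :=
  (forall z i, gcentral z -> gcentral (rhoV i z)) /\
  galois_ext gcentral (fun z => gcentral z /\ gcoinv z) /\
  faithfully_flat (fun z => gcentral z /\ gcoinv z) gcentral.

End Generic.
End HopfDefs.

(* Ore extension A[X, sigma, delta], carried by {poly A} (coefficient list  *)
(* a_0 + a_1 X + ...; the polynomial-ring multiplication of {poly A} is NOT  *)
(* used, only its left A-module structure).                                  *)
Section Ore.
Variables (K : fieldType) (A : algType K) (sigma delta : A -> A).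

(* X * q, using X a = sigma(a) X + delta(a) *)
Definition oreX (q : {poly A}) : {poly A} :=
  'X * map_poly sigma q + map_poly delta q.

Definition ore_mul (p q : {poly A}) : {poly A} :=
  \sum_(i < size p) (p`_i)%:P * iter i oreX q.

End Ore.

(* rho_T (a X^m) = \sum a_<0> X^m (x) a_<1> *)
Definition rhoT (K : fieldType) (n : nat) (A : algType K) (rho : 'I_n -> A -> A)
  (i : 'I_n) (p : {poly A}) : {poly A} := map_poly (rho i) p.

Definition scT (K : fieldType) (A : algType K) (c : K) (p : {poly A}) : {poly A} :=
  map_poly (fun a => c *: a) p.

(* Main.v *)
(* In characteristic zero the trace t of multiplication on the commutative    *)
(* Hopf algebra H is an integral (Delta conjugates multiplication by x into   *)
(* multiplication by Delta x over H) with t(1) = dim H <> 0, and its trace    *)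
(* form is nondegenerate, so some L in H satisfies t(L y) = eps(y) for all y. *)
(* On a comodule algebra put tr(y) = y_0 t(y_1). If c_k, x_k are central with *)
(* \sum_k c_k x_k0 (x) x_k1 = 1 (x) L, then y = \sum_k c_k tr(x_k y): the     *)
(* elements c_k and the maps tr(x_k -) form a dual basis of the center over   *)
(* its coinvariants, and tr retracts the center onto them. Injectivity of the *)
(* Galois map and faithful flatness follow at once. The Galois hypothesis on  *)
(* the fixed central elements of A provides such c_k, x_k as constants in the *)
(* center of the Ore extension.                                               *)
Require Import Defs.
From HB Require Import structures.
From mathcomp Require Import all_boot all_order all_algebra.
Import GRing.Theory.
Local Open Scope ring_scope.
Set Implicit Arguments.
Unset Strict Implicit.
Unset Printing Implicit Defensive.
Import GRing.Theory.
Local Open Scope ring_scope.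

(** * Integrals on a finite-dimensional commutative Hopf algebra *)

(** Both halves rest on facts about an arbitrary comodule algebra. As [H] is commutative, the center
    is a subcomodule ([central_coact]); [sigma] and [delta] commute with the coaction, and (1)
    follows.

    For (2), [centrally_galois_criterion] says that a comodule algebra is centrally Galois as soon
    as every 1 (x) h is the Galois image of a sum of central pairs. [hopf_integrals] supplies an
    integral t and an element L with t(L y) = eps(y); a preimage of 1 (x) L is then a dual basis of
    the center ([coact_trace_dual]), which yields [galois_map_inj] and [coact_faithfully_flat]. The
    Ore extension is a comodule algebra ([ore_mulA], [rhoT_comodule_algebra]) in which central
    elements fixed by [sigma] and killed by [delta] are central constants ([ore_central]), so the
    Galois hypothesis on them provides the required preimages.

    The type [hopf_alg] keeps the two hypotheses as parameters so that the commutative algebra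
    structure they determine can be inferred from it. *)

Definition hopf_alg (K : fieldType) (n : nat) (H : hopf_data K n)
  (hH : is_hopf H) (hC : hopf_commutative H) : Type := 'rV[K]_n.

Section HopfAlg.
Context {K : fieldType} {n : nat} {H : hopf_data K n}.
Variables (hH : is_hopf H) (hC : hopf_commutative H).

Lemma hopf_dim_gt0 : (0 < n)%N.
Proof.
have [_ [_ [_ [_ [_ [_ [_ [_ [e1 _]]]]]]]]] := hH.
case: posnP => // n0; move: e1; rewrite /hcoun big1 => [/esym/eqP|[k kn] _].
  by rewrite oner_eq0.
by exfalso; move: (kn); rewrite n0.
Qed.

Lemma eq_hprod (x x' y y' : 'I_n -> K) :
  x =1 x' -> y =1 y' -> hprod H x y =1 hprod H x' y'.
Proof.
by move=> ex ey k; apply: eq_bigr => i _; apply: eq_bigr => j _; rewrite ex ey.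
Qed.

Lemma eq_hcom (x x' : 'I_n -> K) i j : x =1 x' -> hcom H x i j = hcom H x' i j.
Proof. by move=> ex; apply: eq_bigr => k _; rewrite ex. Qed.

Local Notation HA := (hopf_alg hH hC).

HB.instance Definition _ := GRing.Zmodule.copy HA 'rV[K]_n.
HB.instance Definition _ := GRing.Lmodule.copy HA 'rV[K]_n.

Definition hopf_alg_one : HA := \row_k hunit H k.
Definition hopf_alg_mul (x y : HA) : HA := \row_k hprod H (x 0) (y 0) k.

Let mulA : associative hopf_alg_mul.
Proof.
move=> x y z; apply/rowP => k; rewrite !mxE; have [hA _] := hH.
transitivity (hprod H (x 0) (hprod H (y 0) (z 0)) k).
  by apply: eq_hprod => // i; rewrite mxE.
by rewrite -hA; apply: eq_hprod => // i; rewrite mxE.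
Qed.

Let mulC : commutative hopf_alg_mul.
Proof. by move=> x y; apply/rowP => k; rewrite !mxE hC. Qed.

Let mul1 : left_id hopf_alg_one hopf_alg_mul.
Proof.
move=> x; apply/rowP => k; rewrite !mxE; have [_ [h1 _]] := hH.
by have [<- _] := h1 (x 0) k; apply: eq_hprod => // i; rewrite mxE.
Qed.

Let mulDl : left_distributive hopf_alg_mul +%R.
Proof.
move=> x y z; apply/rowP => k; rewrite !mxE /hprod -big_split /=.
apply: eq_bigr => i _; rewrite -big_split /=; apply: eq_bigr => j _.
by rewrite mxE !mulrDl.
Qed.

Let one_neq0 : hopf_alg_one != 0.
Proof.
have [_ [_ [_ [_ [_ [_ [_ [_ [e1 _]]]]]]]]] := hH.
apply/eqP => /rowP u0; move: e1; rewrite /hcoun big1 => [|i _].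
  by move/esym/eqP; rewrite oner_eq0.
by have := u0 i; rewrite !mxE => ->; rewrite mul0r.
Qed.

HB.instance Definition _ := GRing.Zmodule_isComNzRing.Build HA
  mulA mulC mul1 mulDl one_neq0.

Let scaleAl (a : K) (u v : HA) : a *: (u * v) = (a *: u) * v.
Proof.
apply/rowP => k; rewrite !mxE mulr_sumr; apply: eq_bigr => i _.
by rewrite mulr_sumr; apply: eq_bigr => j _; rewrite mxE !mulrA.
Qed.

HB.instance Definition _ := GRing.Lmodule_isLalgebra.Build K HA scaleAl.
HB.instance Definition _ := GRing.Lalgebra_isComAlgebra.Build K HA.

Definition hopf_basis (i : 'I_n) : HA := delta_mx 0 i.
Local Notation E := hopf_basis.

Lemma hopf_basisE i k : E i 0 k = (k == i)%:R.
Proof. by rewrite mxE eqxx. Qed.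

Lemma hopf_basis_sum (x : HA) : x = \sum_i x 0 i *: E i.
Proof. exact: row_sum_delta. Qed.

Lemma hopf_mulE (x y : HA) k : (x * y) 0 k = hprod H (x 0) (y 0) k.
Proof. by rewrite mxE. Qed.

Lemma hopf_oneE k : (1 : HA) 0 k = hunit H k.
Proof. by rewrite mxE. Qed.

Lemma hopf_scaleE (c : K) (x : HA) k : (c *: x) 0 k = c * x 0 k.
Proof. by rewrite mxE. Qed.

Lemma hopf_sumE (I : Type) (r : seq I) (P : pred I) (F : I -> HA) k :
  (\sum_(i <- r | P i) F i) 0 k = \sum_(i <- r | P i) F i 0 k.
Proof.
by apply: (big_morph (fun x : HA => x 0 k)) => [x y|]; rewrite mxE.
Qed.

Lemma hprod_basisr (x : HA) j k : (x * E j) 0 k = \sum_i x 0 i * hmul H i j k.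
Proof.
rewrite hopf_mulE; apply: eq_bigr => i _; rewrite (bigD1 j) //= big1 => [|l nl].
  by rewrite hopf_basisE eqxx mulr1 addr0.
by rewrite hopf_basisE (negbTE nl) mulr0 mul0r.
Qed.

Lemma hmul_basis i j k : (E i * E j) 0 k = hmul H i j k.
Proof.
rewrite hprod_basisr (bigD1 i) //= big1 => [|l nl].
  by rewrite hopf_basisE eqxx mul1r addr0.
by rewrite hopf_basisE (negbTE nl) mul0r.
Qed.

Lemma hmul_sum i j : E i * E j = \sum_k hmul H i j k *: E k.
Proof.
by rewrite [LHS]hopf_basis_sum; apply: eq_bigr => k _; rewrite hmul_basis.
Qed.

Definition hopf_counit (x : HA) : K := hcoun H (x 0).

(* Delta x = \sum_j hopf_coact j x (x) e_j. *)
Definition hopf_coact (j : 'I_n) (x : HA) : HA := \row_i hcom H (x 0) i j.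

Lemma hopf_coactE j x i : hopf_coact j x 0 i = hcom H (x 0) i j.
Proof. by rewrite mxE. Qed.

Lemma hcom_basis i a b : hcom H (E i 0) a b = hcomul H i a b.
Proof.
rewrite /hcom (bigD1 i) //= big1 => [|l nl].
  by rewrite hopf_basisE eqxx mul1r addr0.
by rewrite hopf_basisE (negbTE nl) mul0r.
Qed.

Lemma hopf_counit_basis i : hopf_counit (E i) = hcounit H i.
Proof.
rewrite /hopf_counit /hcoun (bigD1 i) //= big1 => [|l nl].
  by rewrite hopf_basisE eqxx mul1r addr0.
by rewrite hopf_basisE (negbTE nl) mul0r.
Qed.

Lemma hopf_coactM l x y :
  hopf_coact l (x * y) =
  \sum_b \sum_d hmul H b d l *: (hopf_coact b x * hopf_coact d y).
Proof.
have [_ [_ [_ [_ [_ [hM _]]]]]] := hH.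
apply/rowP => i; rewrite hopf_coactE.
rewrite (eq_hcom i l (fun k => hopf_mulE x y k)) hM /tprod hopf_sumE.
rewrite exchange_big /=; apply: eq_bigr => b _; rewrite hopf_sumE.
under eq_bigr do rewrite exchange_big /=.
rewrite exchange_big /=; apply: eq_bigr => d _.
rewrite hopf_scaleE hopf_mulE /hprod mulr_sumr; apply: eq_bigr => a _.
rewrite mulr_sumr; apply: eq_bigr => c _.
by rewrite !hopf_coactE mulrC !mulrA.
Qed.

Lemma hopf_coact_counit (x : HA) i :
  x 0 i = hopf_counit (\row_j hcom H (x 0) i j).
Proof.
have [_ [_ [_ [_ [hR _]]]]] := hH.
rewrite -[LHS]hR /hopf_counit /hcoun.
by apply: eq_bigr => j _; rewrite mxE.
Qed.

(** The matrix over H of the regular comodule: Delta e_j is the sum over k of its (j, k) entry (x)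
    e_k. *)
Definition coact_mx : 'M[HA]_n := \matrix_(j, k) hopf_coact k (E j).

Lemma hopf_antipode_basis : exists s : 'I_n -> HA,
  (forall k, \sum_i \sum_j hcomul H k i j *: (s i * E j) = (hcounit H k)%:A) /\
  (forall k, \sum_i \sum_j hcomul H k i j *: (E i * s j) = (hcounit H k)%:A).
Proof.
have [_ [_ [_ [_ [_ [_ [_ [_ [_ [S hS]]]]]]]]]] := hH.
pose s i : HA := \row_k S i k; exists s.
have sE i : hlin S (hbasis K i) =1 s i 0.
  move=> k; rewrite mxE /hlin (bigD1 i) //= big1 => [|l nl].
    by rewrite /hbasis eqxx mul1r addr0.
  by rewrite /hbasis (negbTE nl) mul0r.
have bE i : hbasis K i =1 E i 0 by move=> k; rewrite hopf_basisE.
split=> k; apply/rowP => l.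
  have [h _] := hS (E k 0) l; rewrite hopf_scaleE hopf_oneE -hopf_counit_basis.
  rewrite -h hopf_sumE; apply: eq_bigr => i _; rewrite hopf_sumE.
  apply: eq_bigr => j _; rewrite hopf_scaleE hopf_mulE hcom_basis; congr (_ * _).
  by apply: eq_hprod => m; rewrite ?sE ?bE.
have [_ h] := hS (E k 0) l; rewrite hopf_scaleE hopf_oneE -hopf_counit_basis.
rewrite -h hopf_sumE; apply: eq_bigr => i _; rewrite hopf_sumE.
apply: eq_bigr => j _; rewrite hopf_scaleE hopf_mulE hcom_basis; congr (_ * _).
by apply: eq_hprod => m; rewrite ?sE ?bE.
Qed.

(** The inverse is the antipode applied entrywise: coassociativity turns an entry of the product
    into a combination of the S(b_1) b_2 = eps(b). *)
Lemma coact_mx_inv : exists Q : 'M[HA]_n, Q *m coact_mx = 1%:M.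
Proof.
have [s [sE _]] := hopf_antipode_basis.
have [_ [_ [hA [_ [_ _]]]]] := hH; have [_ [_ [_ [_ [hR _]]]]] := hH.
exists (\matrix_(j, k) \sum_i hcomul H j i k *: s i).
apply/matrixP => j l; rewrite !mxE.
transitivity (\sum_b hcomul H j b l *:
    (\sum_i \sum_a hcomul H b i a *: (s i * E a))).
  under [RHS]eq_bigr do rewrite scaler_sumr.
  rewrite [RHS]exchange_big /=.
  under [LHS]eq_bigr do rewrite !mxE mulr_suml.
  rewrite [LHS]exchange_big /=; apply: eq_bigr => i _.
  under [RHS]eq_bigr do rewrite scaler_sumr.
  rewrite [RHS]exchange_big /=.
  transitivity (\sum_a (\sum_k hcomul H j i k * hcomul H k a l) *: (s i * E a)).
    under [RHS]eq_bigr do rewrite scaler_suml.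
    rewrite [RHS]exchange_big /=; apply: eq_bigr => k _.
    rewrite [hopf_coact _ _]hopf_basis_sum mulr_sumr; apply: eq_bigr => a _.
    by rewrite hopf_coactE hcom_basis -scalerAl -scalerAr scalerA.
  apply: eq_bigr => a _.
  under [RHS]eq_bigr do rewrite scalerA.
  rewrite -scaler_suml; congr (_ *: _).
  transitivity (\sum_b hcom H (E j 0) i b * hcomul H b a l).
    by apply: eq_bigr => b _; rewrite hcom_basis.
  by rewrite -hA; apply: eq_bigr => b _; rewrite hcom_basis.
under eq_bigr do rewrite sE scalerA.
rewrite -scaler_suml.
have -> : \sum_b hcomul H j b l * hcounit H b = (j == l)%:R.
  have [_ [_ [_ [hL _]]]] := hH.
  have := hL (E j 0) l; rewrite hopf_basisE eq_sym => <-.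
  by apply: eq_bigr => b _; rewrite hcom_basis.
by rewrite scaler_nat.
Qed.

(** * The trace of the regular representation and its form *)

Definition hopf_trace (x : HA) : K := \sum_j (x * E j) 0 j.

Lemma hopf_traceD x y : hopf_trace (x + y) = hopf_trace x + hopf_trace y.
Proof. by rewrite -big_split; apply: eq_bigr => i _; rewrite mulrDl mxE. Qed.

Lemma hopf_traceZ c x : hopf_trace (c *: x) = c * hopf_trace x.
Proof.
by rewrite mulr_sumr; apply: eq_bigr => i _; rewrite -scalerAl hopf_scaleE.
Qed.

Lemma hopf_trace_sum (I : Type) (r : seq I) (P : pred I) (F : I -> HA) :
  hopf_trace (\sum_(i <- r | P i) F i) = \sum_(i <- r | P i) hopf_trace (F i).
Proof.
apply: (big_morph hopf_trace) => [x y|]; first exact: hopf_traceD.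
by rewrite -[0 in LHS](scale0r (0 : HA)) hopf_traceZ mul0r.
Qed.

Lemma hopf_trace1 : hopf_trace 1 = n%:R.
Proof.
rewrite /hopf_trace; under eq_bigr do rewrite mul1r hopf_basisE eqxx.
by rewrite sumr_const card_ord.
Qed.

(** Delta(e_j x) = Delta(e_j) Delta(x) reads [M *m coact_mx = coact_mx *m N], where [M] is
    multiplication by x and [N] multiplication by Delta x. As [coact_mx] is invertible over a
    commutative ring, the traces of [M] and [N] agree. *)
Lemma hopf_trace_coact x :
  \sum_i hopf_trace (E i) *: hopf_coact i x = (hopf_trace x)%:A.
Proof.
have [Q QP] := coact_mx_inv; have PQ := mulmx1C QP.
pose M : 'M[HA]_n := \matrix_(j, k) ((x * E j) 0 k)%:A.
pose N : 'M[HA]_n := \matrix_(b, l) \sum_d hmul H b d l *: hopf_coact d x.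
have MP : M *m coact_mx = coact_mx *m N.
  apply/matrixP => j l; rewrite !mxE.
  transitivity (hopf_coact l (E j * x)).
    rewrite mulrC; apply/rowP => i; rewrite hopf_coactE hopf_sumE.
    apply: eq_bigr => k _; rewrite [M _ _]mxE [coact_mx _ _]mxE -scalerAl mul1r.
    by rewrite hopf_scaleE hopf_coactE hcom_basis.
  rewrite hopf_coactM; apply: eq_bigr => b _; rewrite !mxE mulr_sumr.
  by apply: eq_bigr => d _; rewrite scalerAr.
have : \tr N = \tr M.
  by rewrite -[M]mulmx1 -PQ mulmxA MP mxtrace_mulC mulmxA QP mul1mx.
rewrite /mxtrace; under eq_bigr do rewrite mxE.
rewrite exchange_big /=; under [in X in _ = X -> _]eq_bigr do rewrite mxE.
rewrite -scaler_suml => <-; apply: eq_bigr => d _; rewrite -scaler_suml.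
by congr (_ *: _); apply: eq_bigr => j _; rewrite mulrC hmul_basis.
Qed.

Lemma hopf_trace_nondeg (char0 : [pchar K] =i pred0) (x : HA) :
  (forall y, hopf_trace (x * y) = 0) -> x = 0.
Proof.
pose N (x : HA) := forall y : HA, hopf_trace (x * y) = 0.
(* The radical N of the trace form is an ideal, and Delta N <= H (x) N by    *)
(* invariance of the trace: hence eps N <= N, and eps N = 0 as N misses 1.   *)
have Ncoact z i : N z -> N (\row_j hcom H (z 0) i j).
  move=> Nz.
  have [Q QP] := coact_mx_inv.
  (* The entry v_b is z_1 t(z_2 e_b). Multiplying by [coact_mx] gives (id (x) t) Delta(e_a z) =
     t(e_a z) 1 = 0, so v = 0; coordinate i of v_b is the trace to be killed. *)
  pose v : 'cV[HA]_n := \col_b \sum_j hopf_trace (E j * E b) *: hopf_coact j z.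
  have Pv : coact_mx *m v = 0.
    apply/matrixP => a k; rewrite mxE [RHS]mxE.
    transitivity (\sum_c hopf_trace (E c) *: hopf_coact c (E a * z)).
      under [RHS]eq_bigr do rewrite hopf_coactM scaler_sumr.
      rewrite [RHS]exchange_big /=; apply: eq_bigr => b _; rewrite !mxE mulr_sumr.
      under [RHS]eq_bigr do rewrite scaler_sumr.
      rewrite [RHS]exchange_big /=; apply: eq_bigr => d _.
      rewrite -scalerAr mulrC [_ * hopf_coact d z]mulrC hmul_sum hopf_trace_sum.
      under [RHS]eq_bigr do rewrite scalerA.
      rewrite -scaler_suml; congr (_ *: _).
      by apply: eq_bigr => c _; rewrite hopf_traceZ mulrC.
    by rewrite hopf_trace_coact mulrC Nz scale0r.
  have v0 : v = 0 by rewrite -[v]mul1mx -QP -mulmxA Pv mulmx0.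
  move=> y; rewrite [y]hopf_basis_sum mulr_sumr hopf_trace_sum big1 // => b _.
  rewrite -scalerAr hopf_traceZ.
  rewrite (hopf_basis_sum (\row_j _)) mulr_suml hopf_trace_sum.
  have /rowP/(_ i) : v b 0 = 0 by rewrite v0 mxE.
  rewrite mxE hopf_sumE [X in _ = X -> _]mxE => vi.
  rewrite [X in _ * X](_ : _ = 0) ?mulr0 // -[RHS]vi; apply: eq_bigr => j _.
  by rewrite -scalerAl hopf_traceZ mulrC hopf_scaleE !mxE.
have epsN z : N z -> hopf_counit z = 0.
  move=> Nz; apply/eqP/negPn/negP => e0.
  have [s [sE _]] := hopf_antipode_basis.
  (* Here eps(z) 1 = S(z_1) z_2 is a combination of multiples of elements of [N], so its trace is 0;
     but that trace is also n eps(z). *)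
  have N1 : hopf_trace (hopf_counit z)%:A = 0.
    transitivity (hopf_trace (\sum_i s i * (\row_j hcom H (z 0) i j))).
      congr hopf_trace; rewrite [z in LHS]hopf_basis_sum.
      transitivity (\sum_k z 0 k *: ((hcounit H k)%:A : HA)).
        rewrite /hopf_counit /hcoun scaler_suml; apply: eq_bigr => k _.
        by rewrite -hopf_basis_sum scalerA.
      under eq_bigr do rewrite -sE scaler_sumr.
      rewrite exchange_big /=; apply: eq_bigr => i _.
      rewrite [X in s i * X]hopf_basis_sum mulr_sumr.
      under eq_bigr do rewrite scaler_sumr.
      rewrite exchange_big /=; apply: eq_bigr => j _.
      under eq_bigr do rewrite scalerA.
      by rewrite -scaler_suml -scalerAr mxE.
    rewrite hopf_trace_sum big1 // => i _; rewrite mulrC; exact: Ncoact.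
  move: N1; rewrite hopf_traceZ hopf_trace1 => /eqP; rewrite mulf_eq0 (negbTE e0).
  by rewrite ((pcharf0P K).1 char0) -leqn0 leqNgt hopf_dim_gt0.
move=> Nx; apply/rowP => i; rewrite hopf_coact_counit mxE.
exact/epsN/Ncoact.
Qed.

(** t is the trace divided by n, which normalizes t(1) to 1; L represents the counit through the
    nondegenerate trace form. *)
Lemma hopf_integrals (char0 : [pchar K] =i pred0) :
  exists t L : 'I_n -> K,
    [/\ forall k i, \sum_j hcomul H k i j * t j = t k * hunit H i,
        \sum_j hunit H j * t j = 1 &
        forall j, \sum_i L i * (\sum_k hmul H i j k * t k) = hcounit H j].
Proof.
have n0 : n%:R != 0 :> K.
  by rewrite ((pcharf0P K).1 char0) -lt0n hopf_dim_gt0.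
pose t i := hopf_trace (E i) / n%:R.
have tE (x : HA) : \sum_k x 0 k * t k = hopf_trace x / n%:R.
  rewrite [x in RHS]hopf_basis_sum hopf_trace_sum mulr_suml.
  by apply: eq_bigr => k _; rewrite hopf_traceZ mulrA.
pose G : 'M[K]_n := \matrix_(i, j) (hopf_trace (E i * E j) / n%:R).
(* A row of the left kernel of the Gram matrix is an element orthogonal to every basis vector, hence
   zero. *)
have Gfree : G \in unitmx.
  rewrite -row_free_unit -kermx_eq0; apply/eqP/row_matrixP => r.
  rewrite row0; set x := row r _.
  have xG : x *m G = 0 by apply/eqP; rewrite -sub_kermx row_sub.
  apply: (hopf_trace_nondeg char0 (x := x)) => y.
  rewrite [y]hopf_basis_sum mulr_sumr hopf_trace_sum big1 // => j _.
  rewrite -scalerAr hopf_traceZ (hopf_basis_sum x).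
  rewrite mulr_suml hopf_trace_sum.
  have /rowP/(_ j) := xG; rewrite !mxE => /(congr1 (fun c => c * n%:R)).
  rewrite mul0r mulr_suml => xj; rewrite [X in _ * X](_ : _ = 0) ?mulr0 // -[RHS]xj.
  by apply: eq_bigr => i _; rewrite -scalerAl hopf_traceZ [G _ _]mxE -mulrA divfK.
exists t; exists (fun i => ((\row_j hcounit H j) *m invmx G) 0 i); split.
- move=> k i; have /rowP/(_ i) := hopf_trace_coact (E k).
  rewrite hopf_scaleE hopf_oneE hopf_sumE => /(congr1 (fun c => c / n%:R)).
  rewrite mulr_suml => tk; rewrite mulrAC -[RHS]tk; apply: eq_bigr => j _.
  by rewrite hopf_scaleE hopf_coactE hcom_basis mulrAC mulrC.
- transitivity (\sum_k (1 : HA) 0 k * t k).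
    by apply: eq_bigr => k _; rewrite hopf_oneE.
  by rewrite tE hopf_trace1 divff.
move=> j; transitivity ((((\row_j hcounit H j) *m invmx G) *m G) 0 j).
  rewrite [RHS]mxE; apply: eq_bigr => i _; congr (_ * _); rewrite [RHS]mxE -tE.
  by apply: eq_bigr => k _; rewrite hmul_basis.
by rewrite mulmxKV // mxE.
Qed.

End HopfAlg.

(** * Centers of comodule algebras *)

Lemma sum_closed (V : zmodType) (C : V -> Prop) :
  C 0 -> (forall a b, C a -> C b -> C (a + b)) ->
  forall (I : eqType) (r : seq I) (F : I -> V),
  (forall i, i \in r -> C (F i)) -> C (\sum_(i <- r) F i).
Proof.
move=> C0 CD I r F CF; rewrite big_seq; elim/big_ind: _ => // i; exact: CF.
Qed.

(** Balanced maps are additive only on members of the given predicates, so the usual morphism lemma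
    for sums does not apply to them. *)
Lemma additive_on_sum (V M : zmodType) (C : V -> Prop) (h : V -> M) :
  C 0 -> (forall a b, C a -> C b -> C (a + b)) ->
  (forall a b, C a -> C b -> h (a + b) = h a + h b) ->
  forall (I : eqType) (r : seq I) (F : I -> V),
  (forall i, i \in r -> C (F i)) ->
  h (\sum_(i <- r) F i) = \sum_(i <- r) h (F i).
Proof.
move=> C0 CD hD I r F; elim: r => [|i r IHr] CF.
  by rewrite !big_nil; apply: (addrI (h 0)); rewrite -hD // !addr0.
have CFr j : j \in r -> C (F j) by move=> jr; apply: CF; rewrite inE jr orbT.
rewrite !big_cons hD ?IHr //; first by apply: CF; rewrite inE eqxx.
exact: sum_closed.
Qed.

Section KLinear.
Context {K : fieldType} {A : algType K} (f : A -> A).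
Hypothesis fK : klinear f.

Lemma klinearD a b : f (a + b) = f a + f b.
Proof. by rewrite -[a]scale1r fK !scale1r. Qed.

Lemma klinear0 : f 0 = 0.
Proof. by apply: (addrI (f 0)); rewrite -klinearD !addr0. Qed.

Lemma klinearZ c a : f (c *: a) = c *: f a.
Proof. by rewrite -[c *: a]addr0 fK klinear0 addr0. Qed.

Lemma klinear_sum (I : Type) (r : seq I) (P : pred I) (F : I -> A) :
  f (\sum_(i <- r | P i) F i) = \sum_(i <- r | P i) f (F i).
Proof. by apply: (big_morph f) => [a b|]; [exact: klinearD|exact: klinear0]. Qed.

End KLinear.

Section ComoduleAlgebraTheory.
Context {K : fieldType} {n : nat} {H : hopf_data K n}.
Hypotheses (hH : is_hopf H) (hC : hopf_commutative H).
Context {A : algType K} {rho : 'I_n -> A -> A}.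
Hypothesis rhoP : comodule_algebra H rho.

Let rhoK i : klinear (rho i). Proof. by case: rhoP. Qed.

Let rho_rho a i j : rho j (rho i a) = \sum_k hcomul H k j i *: rho k a.
Proof. by case: rhoP => _ []. Qed.

Let rho_counit a : \sum_i hcounit H i *: rho i a = a.
Proof. by case: rhoP => _ [_ []]. Qed.

Let rhoM a b k : rho k (a * b) =
  \sum_i \sum_j hmul H i j k *: (rho i a * rho j b).
Proof. by case: rhoP => _ [_ [_ []]]. Qed.

Let rho1 k : rho k 1 = hunit H k *: 1.
Proof. by case: rhoP => _ [_ [_ []]]. Qed.

(* With rho(z) central against rho(a) = a_0 (x) a_1 and against 1 (x) H, it   *)
(* commutes with a (x) 1 = a_0 (x) a_1 S(a_2).                                *)
Lemma central_coact z i : central z -> central (rho i z).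
Proof.
move=> zc a; have [s [_ sE]] := hopf_antipode_basis hH hC.
pose E := hopf_basis hH hC.
(* The coordinates of a (x) 1 = a_0 (x) a_1 S(a_2). *)
have aE m : \sum_q \sum_j (E q * s j) 0 m *: rho q (rho j a) = hunit H m *: a.
  rewrite -[in RHS](rho_counit a) scaler_sumr.
  under eq_bigr do under eq_bigr do rewrite rho_rho scaler_sumr.
  under eq_bigr do rewrite exchange_big /=.
  rewrite exchange_big /=; apply: eq_bigr => k _.
  under eq_bigr do under eq_bigr do rewrite scalerA.
  under eq_bigr do rewrite -scaler_suml.
  rewrite -scaler_suml scalerA; congr (_ *: _).
  transitivity (((hcounit H k)%:A : hopf_alg hH hC) 0 m).
    rewrite -sE hopf_sumE; apply: eq_bigr => q _; rewrite hopf_sumE.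
    by apply: eq_bigr => j _; rewrite hopf_scaleE mulrC.
  by rewrite hopf_scaleE hopf_oneE mulrC.
(* The coordinates of rho(z a_0) (1 (x) S(a_1)). *)
pose X := \sum_k \sum_j (E k * s j) 0 i *: rho k (z * rho j a).
have hE p q j : \sum_k hmul H p q k * (E k * s j) 0 i =
    \sum_m hmul H p m i * (E q * s j) 0 m.
  transitivity ((E p * E q * s j) 0 i).
    rewrite hmul_sum mulr_suml hopf_sumE; apply: eq_bigr => k _.
    by rewrite -scalerAl hopf_scaleE.
  rewrite -mulrA [X in E p * X]hopf_basis_sum mulr_sumr hopf_sumE.
  by apply: eq_bigr => m _; rewrite -scalerAr hopf_scaleE hmul_basis mulrC.
have hU p : \sum_m hmul H p m i * hunit H m = (E p) 0 i.
  rewrite -[E p in RHS]mulr1 [1 in RHS]hopf_basis_sum mulr_sumr hopf_sumE.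
  apply: eq_bigr => m _.
  by rewrite -scalerAr hopf_scaleE hmul_basis hopf_oneE mulrC.
have sel (F : 'I_n -> A) : \sum_p (E p) 0 i *: F p = F i.
  rewrite (bigD1 i) //= big1 => [|p ne].
    by rewrite hopf_basisE eqxx scale1r addr0.
  by rewrite hopf_basisE eq_sym (negbTE ne) scale0r.
(* One computation serves for left and right multiplication by [a]: [op] is the product in A or its
   opposite, and both evaluations start from [X]. *)
have main (op : A -> A -> A) (y : A -> A -> A) :
    (forall u, {morph op u : v w / v + w}) ->
    (forall c u v, op u (c *: v) = c *: op u v) -> (forall u, op u 0 = 0) ->
    (forall k j, rho k (y z (rho j a)) =
       \sum_p \sum_q hmul H p q k *: op (rho p z) (rho q (rho j a))) ->
    \sum_k \sum_j (E k * s j) 0 i *: rho k (y z (rho j a)) = op (rho i z) a.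
  move=> opD opZ op0 yE.
  have opS u (F : 'I_n -> A) : op u (\sum_q F q) = \sum_q op u (F q).
    exact: (big_morph (op u) (opD u) (op0 u)).
  transitivity (\sum_p \sum_q \sum_j
      (\sum_k hmul H p q k * (E k * s j) 0 i) *: op (rho p z) (rho q (rho j a))).
    under eq_bigr do under eq_bigr do rewrite yE scaler_sumr.
    under eq_bigr do rewrite exchange_big /=.
    rewrite exchange_big /=; apply: eq_bigr => p _.
    under eq_bigr do under eq_bigr do rewrite scaler_sumr.
    under eq_bigr do rewrite exchange_big /=.
    rewrite exchange_big /=; apply: eq_bigr => q _.
    rewrite exchange_big /=; apply: eq_bigr => j _.
    rewrite scaler_suml; apply: eq_bigr => k _.
    by rewrite scalerA mulrC.
  under eq_bigr do under eq_bigr do under eq_bigr do rewrite hE.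
  rewrite -[RHS](sel (fun p => op (rho p z) a)); apply: eq_bigr => p _.
  transitivity (\sum_m hmul H p m i *:
      op (rho p z) (\sum_q \sum_j (E q * s j) 0 m *: rho q (rho j a))).
    under [RHS]eq_bigr do rewrite opS scaler_sumr.
    rewrite [RHS]exchange_big /=; apply: eq_bigr => q _.
    under [RHS]eq_bigr do rewrite opS scaler_sumr.
    rewrite [RHS]exchange_big /=; apply: eq_bigr => j _.
    rewrite scaler_suml; apply: eq_bigr => m _.
    by rewrite opZ scalerA.
  under eq_bigr do rewrite aE opZ scalerA.
  by rewrite -scaler_suml hU.
transitivity X.
  apply/esym/(main *%R *%R) => [u v w|c u v|u|k j].
  - exact: mulrDr.
  - by rewrite scalerAr.
  - exact: mulr0.
  exact: rhoM.
apply: (main (fun u v => v * u) *%R) => [u v w|c u v|u|k j].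
- exact: mulrDl.
- by rewrite scalerAl.
- exact: mul0r.
(* Replacing z a_0 by a_0 z reverses the factors in H as well; commutativity of H puts them back. *)
rewrite zc rhoM exchange_big /=; apply: eq_bigr => p _; apply: eq_bigr => q _.
by congr (_ *: _); rewrite -!(hmul_basis hH hC) mulrC.
Qed.

Lemma central_subalgebra : comodule_subalgebra rho (@central K A).
Proof.
split; last by move=> a i; exact: central_coact.
split=> [a|]; first by rewrite mul1r mulr1.
split=> [a b ac bc x|]; first by rewrite mulrDl mulrDr ac bc.
split=> [c a ac x|a b ac bc x]; first by rewrite -scalerAl -scalerAr ac.
by rewrite -mulrA bc !mulrA ac.
Qed.

Local Notation C := (gcentral (@GRing.mul A)).
Local Notation C0 := (fun z : A => gcentral *%R z /\ gcoinv H rho *:%R z).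

Let C_0 : C 0. Proof. by move=> a; rewrite mul0r mulr0. Qed.
Let C_1 : C 1. Proof. by case: central_subalgebra => -[]. Qed.
Let C_D a b : C a -> C b -> C (a + b).
Proof. by case: central_subalgebra => -[_ [h _]] _; exact: h. Qed.
Let C_Z c a : C a -> C (c *: a).
Proof. by case: central_subalgebra => -[_ [_ [h _]]] _; exact: h. Qed.
Let C_M a b : C a -> C b -> C (a * b).
Proof. by case: central_subalgebra => -[_ [_ [_ h]]] _; exact: h. Qed.
Let C_rho i a : C a -> C (rho i a).
Proof. exact: central_coact. Qed.

(** * The trace from the center to its coinvariants *)

Variables t L : 'I_n -> K.
Hypothesis t_coinv : forall k i, \sum_j hcomul H k i j * t j = t k * hunit H i.
Hypothesis t_unit : \sum_j hunit H j * t j = 1.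
Hypothesis tL :
  forall j, \sum_i L i * (\sum_k hmul H i j k * t k) = hcounit H j.

Definition coact_trace (z : A) : A := \sum_i t i *: rho i z.
Local Notation tr := coact_trace.

Lemma coact_traceD a b : tr (a + b) = tr a + tr b.
Proof.
by rewrite -big_split; apply: eq_bigr => i _; rewrite klinearD // scalerDr.
Qed.

Lemma coact_trace1 : tr 1 = 1.
Proof.
rewrite /tr; under eq_bigr do rewrite rho1 scalerA mulrC.
by rewrite -scaler_suml t_unit scale1r.
Qed.

Lemma coact_traceM a b : tr (a * b) =
  \sum_i \sum_j (\sum_k hmul H i j k * t k) *: (rho i a * rho j b).
Proof.
rewrite /tr; under eq_bigr do rewrite rhoM scaler_sumr.
rewrite exchange_big /=; apply: eq_bigr => i _.
under eq_bigr do rewrite scaler_sumr.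
rewrite exchange_big /=; apply: eq_bigr => j _.
by rewrite scaler_suml; apply: eq_bigr => k _; rewrite scalerA mulrC.
Qed.

(** By invariance of t, rho(tr z) = z_0 (x) z_1 t(z_2) = tr(z) (x) 1. *)
Lemma coact_trace_coinv z : C z -> C0 (tr z).
Proof.
move=> zc; split.
  apply: (sum_closed (C := C)) => // i _; exact/C_Z/C_rho.
move=> i; rewrite klinear_sum //.
under eq_bigr do rewrite klinearZ // rho_rho scaler_sumr.
rewrite exchange_big scaler_sumr /=; apply: eq_bigr => k _.
under eq_bigr do rewrite scalerA.
rewrite -scaler_suml scalerA; congr (_ *: _); rewrite [RHS]mulrC -t_coinv.
by apply: eq_bigr => j _; rewrite mulrC.
Qed.

Lemma coact_trace_linear r z : C0 r -> tr (r * z) = r * tr z.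
Proof.
move=> [rc ri]; rewrite mulr_sumr; apply: eq_bigr => k _.
rewrite -scalerAr; congr (_ *: _); rewrite rhoM exchange_big /=.
transitivity (\sum_j (j == k)%:R *: (r * rho j z)).
  apply: eq_bigr => j _.
  under eq_bigr do rewrite ri -scalerAl scalerA.
  rewrite -scaler_suml; congr (_ *: _).
  transitivity ((1 * hopf_basis hH hC j) 0 k).
    rewrite hprod_basisr; apply: eq_bigr => i _.
    by rewrite hopf_oneE mulrC.
  by rewrite mul1r hopf_basisE eq_sym.
rewrite (bigD1 k) //= big1 => [|j ne]; first by rewrite eqxx scale1r addr0.
by rewrite (negbTE ne) scale0r.
Qed.

(** * Injectivity of the Galois map and faithful flatness from a dual basis *)

Section DualBasis.
Variable d : seq (A * A).
Hypothesis dC : in_C2 C d.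
Hypothesis dL : forall i, galois_map *%R rho d i = L i *: 1.

Let dC1 p : p \in d -> C p.1. Proof. by move/dC => []. Qed.
Let dC2 p : p \in d -> C p.2. Proof. by move/dC => []. Qed.

(** By the choice of [d] the sum is y_0 t(L y_1) = y_0 eps(y_1). *)
Lemma coact_trace_dual y : \sum_(p <- d) p.1 * tr (p.2 * y) = y.
Proof.
rewrite -[RHS]rho_counit.
transitivity (\sum_i \sum_j (\sum_k hmul H i j k * t k) *:
    (galois_map *%R rho d i * rho j y)).
  under eq_bigr do rewrite coact_traceM mulr_sumr.
  rewrite exchange_big /=; apply: eq_bigr => i _.
  under eq_bigr do rewrite mulr_sumr.
  rewrite exchange_big /=; apply: eq_bigr => j _.
  rewrite mulr_suml scaler_sumr; apply: eq_bigr => p _.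
  by rewrite -scalerAr mulrA.
rewrite exchange_big /=; apply: eq_bigr => j _.
under eq_bigr do rewrite dL -scalerAl mul1r scalerA.
rewrite -scaler_suml -tL; congr (_ *: _).
by apply: eq_bigr => i _; rewrite mulrC.
Qed.

(** Expanding x in the dual basis and moving the coinvariant traces across gives c (x) x = \sum_k c
    tr(x_k x) (x) c_k. Since x_k0 is central, c tr(x_k x) = x_k0 c x_0 t(x_k1 x_1) depends only on
    the Galois image of c (x) x. *)
Lemma galois_map_inj u v : in_C2 C u -> in_C2 C v ->
  (forall i, galois_map *%R rho u i = galois_map *%R rho v i) ->
  tensor_eq *%R C C0 u v.
Proof.
move=> uC vC uv M f [fl [fr fb]].
have expand w : in_C2 C w -> \sum_(p <- w) f p.1 p.2 =
    \sum_(q <- d) f (\sum_i \sum_j (\sum_k hmul H i j k * t k) *: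
       (rho i q.2 * galois_map *%R rho w j)) q.1.
  move=> wC; have wC1 p : p \in w -> C p.1 by move/wC => [].
  have wC2 p : p \in w -> C p.2 by move/wC => [].
  have trC p q : p \in w -> q \in d -> C0 (tr (q.2 * p.2)).
    by move=> pw qd; apply/coact_trace_coinv/C_M; [exact: dC2|exact: wC2].
  transitivity (\sum_(p <- w) \sum_(q <- d) f (p.1 * tr (q.2 * p.2)) q.1).
    rewrite big_seq [RHS]big_seq; apply: eq_bigr => p pw.
    rewrite -[p.2 in LHS]coact_trace_dual.
    rewrite (additive_on_sum (C := C)) // => [|a b ac bc|q qd].
    - rewrite big_seq [RHS]big_seq; apply: eq_bigr => q qd.
      have [tc ti] := trC _ _ pw qd.
      by rewrite -tc -fb //; [exact: wC1|exact: dC1].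
    - by apply: fr => //; exact: wC1.
    apply: C_M; first exact: dC1.
    by have [] := trC _ _ pw qd.
  rewrite exchange_big /= big_seq [RHS]big_seq; apply: eq_bigr => q qd.
  rewrite -(additive_on_sum (C := C) (h := f^~ q.1)) // => [|a b ac bc|p pw].
  - congr f; under [LHS]eq_bigr do rewrite coact_traceM mulr_sumr.
    rewrite exchange_big /=; apply: eq_bigr => i _.
    under [LHS]eq_bigr do rewrite mulr_sumr.
    rewrite exchange_big /=; apply: eq_bigr => j _.
    rewrite mulr_sumr scaler_sumr; apply: eq_bigr => p _.
    by rewrite -scalerAr !mulrA (C_rho i (dC2 qd)).
  - by apply: fl => //; exact: dC1.
  apply: C_M; first exact: wC1.
  by have [] := trC _ _ pw qd.
rewrite !expand //; apply: eq_bigr => q _; congr f.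
by apply: eq_bigr => i _; apply: eq_bigr => j _; rewrite uv.
Qed.

Section Modules.
Variables (M : zmodType) (act : A -> M -> M).
Hypothesis actP : rmod *%R 1 C0 act.

Let coef (q : A * A) (s : seq (M * A)) : M :=
  \sum_(p <- s) act (tr (q.2 * p.2)) p.1.

(** Hence the dual basis coefficients of a formal sum depend only on its class in the tensor
    product. *)
Lemma dual_mbalanced x (xC : C x) :
  mbalanced *%R C0 C act (fun m z => act (tr (x * z)) m).
Proof.
have [aD [Da [aM a1]]] := actP.
have trC z : C z -> C0 (tr (x * z)).
  by move=> zc; apply/coact_trace_coinv/C_M.
split=> [m m' z zc|]; first by apply: aD; exact: trC.
split=> [m z z' zc zc'|r m z rc zc].
  by rewrite mulrDr coact_traceD; apply: Da; exact: trC.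
rewrite -aM //; last exact: trC.
have -> : x * (r * z) = r * (x * z) by rewrite mulrA -(rc.1 x) -mulrA.
by rewrite (coact_trace_linear _ rc) rc.1.
Qed.

Lemma mtensor_expand (P : zmodType) (g : M -> A -> P) (s : seq (M * A)) :
  mbalanced *%R C0 C act g -> in_Z C s ->
  \sum_(p <- s) g p.1 p.2 = \sum_(q <- d) g (coef q s) q.1.
Proof.
move=> [gl [gr gb]] sC.
have trC p q : p \in s -> q \in d -> C0 (tr (q.2 * p.2)).
  by move=> ps qd; apply/coact_trace_coinv/C_M; [exact: dC2|exact: sC].
transitivity (\sum_(p <- s) \sum_(q <- d) g (act (tr (q.2 * p.2)) p.1) q.1).
  rewrite big_seq [RHS]big_seq; apply: eq_bigr => p ps.
  rewrite -[p.2 in LHS]coact_trace_dual.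
  rewrite (additive_on_sum (C := C)) // => [|a b ac bc|q qd].
  - rewrite big_seq [RHS]big_seq; apply: eq_bigr => q qd.
    have tc := trC _ _ ps qd.
    by rewrite gb //; [rewrite tc.1|exact: dC1].
  - exact: gr.
  apply: C_M; first exact: dC1.
  by have [] := trC _ _ ps qd.
rewrite exchange_big /= big_seq [RHS]big_seq; apply: eq_bigr => q qd.
rewrite -(additive_on_sum (C := fun=> True) (h := g^~ q.1)) // => a b _ _.
apply: gl; exact: dC1.
Qed.

End Modules.

(** Exactness passes to the tensored sequence coefficient by coefficient along the dual basis, and
    comes back through the retraction given by the trace. *)
Lemma coact_faithfully_flat : faithfully_flat *%R 1 C0 C.
Proof.
move=> M1 M2 M3 a1 a2 a3 f g m1 m2 m3 [fD fZ] [gD gZ].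
have f0 : f 0 = 0 by apply: (addrI (f 0)); rewrite -fD !addr0.
have g0 : g 0 = 0 by apply: (addrI (g 0)); rewrite -gD !addr0.
(* As tr(1) = 1, the balanced map m (x) z |-> tr(z) m is a left inverse of m |-> m (x) 1. *)
have trbal (M : zmodType) (act : A -> M -> M) : rmod *%R 1 C0 act ->
    mbalanced *%R C0 C act (fun m z => act (tr (1 * z)) m).
  by move=> actP; apply: dual_mbalanced.
have tr11 : tr (1 * 1) = 1 by rewrite mul1r coact_trace1.
have act1 (M : zmodType) (act : A -> M -> M) :
    rmod *%R 1 C0 act -> forall m, act 1 m = m.
  by case=> _ [_ []].
split=> [ex s sC|ex m]; split.
- move=> gs0.
  have trC p q : p \in s -> q \in d -> C0 (tr (q.2 * p.2)).
    by move=> ps qd; apply/coact_trace_coinv/C_M; [exact: dC2|exact: sC].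
  pose c (q : A * A) := \sum_(p <- s) a2 (tr (q.2 * p.2)) p.1.
  (* Evaluating m (x) z |-> tr(q.2 z) m on the vanishing image of [s] shows that g kills the
     coefficient [c q]. *)
  have lift q : q \in d -> exists m', f m' = c q.
    move=> qd; apply/ex; rewrite (big_morph g gD g0).
    have := gs0 _ _ (dual_mbalanced m3 (dC2 qd)).
    rewrite big_nil big_map /= => sum0; rewrite -[RHS]sum0.
    rewrite big_seq [RHS]big_seq; apply: eq_bigr => p ps.
    by rewrite gZ //; exact: trC.
  have [s' s'E] : exists s' : seq (M1 * A),
      [seq (f p.1, p.2) | p <- s'] = [seq (c q, q.1) | q <- d].
    elim: d lift => [|q d' IHd] lift; first by exists [::].
    have [|s' s'E] := IHd; first by move=> p pd; apply: lift; rewrite inE pd orbT.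
    have [|m' m'E] := lift q; first by rewrite inE eqxx.
    by exists ((m', q.1) :: s'); rewrite /= m'E s'E.
  exists s'; split=> [p ps'|P h hbal].
    have /mapP [q qd [_ ->]] : (f p.1, p.2) \in [seq (c q, q.1) | q <- d].
      by rewrite -s'E; apply: map_f.
    exact: dC1.
  by rewrite s'E big_map (mtensor_expand hbal).
- move=> [s' [s'C s'E]] P h [hl [hr hb]].
  have := s'E _ (fun m z => h (g m) z); rewrite !big_map big_nil /= => <-.
    rewrite big_seq big1 // => p ps'.
    have -> : g (f p.1) = 0 by apply/ex; exists p.1.
    have pC := s'C _ ps'.
    by apply: (addrI (h 0 p.2)); rewrite -hl // !addr0.
  split=> [x y z zC|]; first by rewrite gD hl.
  by split=> [x y z yC zC|r x z rC zC]; [exact: hr|rewrite gZ // hb].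
- move=> gm0; have mC : in_Z C [:: (m, 1 : A)].
    by move=> p; rewrite inE => /eqP ->.
  have [|s' [s'C s'E]] := (ex _ mC).1.
    move=> P h [hl _]; rewrite big_seq1 big_nil /= gm0.
    by apply: (addrI (h 0 1)); rewrite -hl // !addr0.
  exists (\sum_(p <- s') a1 (tr (1 * p.2)) p.1).
  have := s'E _ _ (trbal _ _ m2); rewrite big_map big_seq1 /= tr11 act1 // => <-.
  rewrite (big_morph f fD f0) big_seq [RHS]big_seq; apply: eq_bigr => p ps'.
  by apply: fZ; apply/coact_trace_coinv/C_M => //; exact: s'C.
move=> [m' <-].
have mC : in_Z C [:: (f m', 1 : A)] by move=> p; rewrite inE => /eqP ->.
have [_ ex'] := ex _ mC.
have /ex' : exists s' : seq (M1 * A), in_Z C s' /\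
    mtensor_eq *%R C0 C a2 [seq (f p.1, p.2) | p <- s'] [:: (f m', 1)].
  exists [:: (m', 1)]; split=> [p|P h hbal]; last by [].
  by rewrite inE => /eqP ->.
move/(_ _ _ (trbal _ _ m3)).
by rewrite big_seq1 big_nil /= tr11 act1.
Qed.

End DualBasis.
End ComoduleAlgebraTheory.

Theorem centrally_galois_criterion (K : fieldType) (n : nat) (H : hopf_data K n)
    (A : algType K) (rho : 'I_n -> A -> A) :
  [pchar K] =i pred0 -> is_hopf H -> hopf_commutative H ->
  comodule_algebra H rho ->
  (forall x : 'I_n -> K, exists s, in_C2 (gcentral *%R) s /\
     forall i, galois_map *%R rho s i = x i *: 1) ->
  centrally_galois H *%R 1 rho *:%R.
Proof.
move=> char0 hH hC rhoP surj.
have [t [L [t_coinv t_unit tL]]] := hopf_integrals hH hC char0.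
have [d [dC dL]] := surj L.
split; first by move=> z i; exact: (central_coact hH hC rhoP).
split; last exact: (coact_faithfully_flat hH hC rhoP t_coinv t_unit tL dC dL).
split; first by move=> s u; exact: (galois_map_inj hH hC rhoP t_coinv tL dC dL).
move=> y yC.
(* [s j] is a preimage of 1 (x) e_j; multiplying its left entries by the central [y j] and
   concatenating gives a preimage of y. *)
have [s sP] := fin_all_exists (fun j => surj (fun i => (i == j)%:R)).
exists (flatten [seq [seq (y j * p.1, p.2) | p <- s j] | j <- enum 'I_n]).
split=> [p|i].
  move=> /flatten_mapP [j _ /mapP [q qs ->]] /=.
  have [[sC _] [q1 q2]] := (sP j, (sP j).1 _ qs); split=> // a.
  by rewrite -mulrA q1 !mulrA (yC j).
rewrite /galois_map big_flatten big_map /=.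
rewrite (eq_bigr (fun j => (i == j)%:R *: y j)) => [|j _].
  rewrite (bigD1_seq i) ?mem_enum ?enum_uniq //= eqxx scale1r.
  by rewrite big1 ?addr0 // => j; rewrite eq_sym => /negbTE ->; rewrite scale0r.
rewrite big_map /=; under eq_bigr do rewrite -mulrA.
by rewrite -mulr_sumr; have := (sP j).2 i; rewrite /galois_map => ->;
  rewrite -scalerAr mulr1.
Qed.

(** * Ore extensions *)

Section OreTheory.
Context {K : fieldType} {A : algType K} {sigma delta : A -> A}.
Hypotheses (sigmaP : alg_map sigma) (deltaP : sigma_derivation sigma delta).

Let sigmaK : klinear sigma. Proof. by case: sigmaP. Qed.
Let sigmaM a b : sigma (a * b) = sigma a * sigma b.
Proof. by case: sigmaP => _ []. Qed.
Let sigma1 : sigma 1 = 1. Proof. by case: sigmaP => _ []. Qed.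
Let deltaK : klinear delta. Proof. by case: deltaP. Qed.
Let deltaM a b : delta (a * b) = sigma a * delta b + delta a * b.
Proof. by case: deltaP. Qed.

Lemma sigma_derivation1 : delta 1 = 0.
Proof.
have := deltaM 1 1; rewrite sigma1 !mul1r mulr1 => /eqP.
by rewrite -subr_eq0 opprD addrA subrr add0r oppr_eq0 => /eqP.
Qed.

Local Notation oX := (oreX sigma delta).
Local Notation oM := (ore_mul sigma delta).

Lemma coef_oreX q i :
  (oX q)`_i = (if i is j.+1 then sigma q`_j else 0) + delta q`_i.
Proof.
rewrite coefD coefXM (coef_map_id0 _ _ (klinear0 deltaK)).
by case: i => //= i; rewrite (coef_map_id0 _ _ (klinear0 sigmaK)).
Qed.

Lemma oreXD p q : oX (p + q) = oX p + oX q.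
Proof.
apply/polyP => i; rewrite [RHS]coefD !coef_oreX.
rewrite coefD (klinearD deltaK); case: i => [|i]; first by rewrite !add0r.
by rewrite coefD (klinearD sigmaK) addrACA.
Qed.

Lemma oreX0 : oX 0 = 0.
Proof.
apply/polyP => -[|i]; rewrite coef_oreX !coef0 (klinear0 deltaK) addr0 //.
exact: klinear0.
Qed.

Lemma oreX_polyC a q :
  oX (a%:P * q) = (sigma a)%:P * oX q + (delta a)%:P * q.
Proof.
apply/polyP => i; rewrite [RHS]coefD !coefCM !coef_oreX coefCM deltaM mulrDr.
by case: i => [|i]; rewrite ?coefCM ?sigmaM ?mulr0 addrA.
Qed.

Lemma iter_oreXD m p q : iter m oX (p + q) = iter m oX p + iter m oX q.
Proof. by elim: m => //= m ->; rewrite oreXD. Qed.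

Lemma iter_oreX_fixed a m q : sigma a = a -> delta a = 0 ->
  iter m oX (a%:P * q) = a%:P * iter m oX q.
Proof.
by move=> sa da; elim: m => //= m ->; rewrite oreX_polyC sa da mul0r addr0.
Qed.

Lemma iter_oreX1 m : iter m oX 1 = 'X^m.
Proof.
elim: m => //= m ->; apply/polyP => i; rewrite coef_oreX !coefXn.
have d01 (b : bool) : delta b%:R = 0.
  by case: b; rewrite ?sigma_derivation1 ?(klinear0 deltaK).
rewrite d01 addr0; case: i => [|i] //; rewrite coefXn eqSS.
by case: eqP; rewrite ?sigma1 ?(klinear0 sigmaK).
Qed.

(** Extra indices carry zero coefficients, so products whose left factors differ in size can be
    compared over a common range. *)
Lemma ore_mulE N (p q : {poly A}) : (size p <= N)%N ->
  oM p q = \sum_(i < N) (p`_i)%:P * iter i oX q.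
Proof.
move=> pN; rewrite /ore_mul (big_ord_widen N (fun i => (p`_i)%:P * iter i oX q)) //.
rewrite big_mkcond /=; apply: eq_bigr => i _; case: ltnP => // ip.
by rewrite nth_default // mul0r.
Qed.

Lemma ore_mulDl p q r : oM (p + q) r = oM p r + oM q r.
Proof.
have := leq_maxl (size p) (size q); have := leq_maxr (size p) (size q).
move=> qN pN; rewrite !(@ore_mulE (maxn (size p) (size q))) ?size_polyD //.
by rewrite -big_split; apply: eq_bigr => i _; rewrite coefD polyCD mulrDl.
Qed.

Lemma ore_mulDr p q r : oM p (q + r) = oM p q + oM p r.
Proof.
by rewrite -big_split; apply: eq_bigr => i _; rewrite iter_oreXD mulrDr.
Qed.

Lemma ore_mul0l q : oM 0 q = 0.
Proof. by rewrite /ore_mul size_poly0 big_ord0. Qed.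

Lemma ore_mul_suml (I : Type) (r : seq I) (P : pred I) (F : I -> {poly A}) q :
  oM (\sum_(i <- r | P i) F i) q = \sum_(i <- r | P i) oM (F i) q.
Proof.
by apply: (big_morph (oM^~ q)) => [x y|]; rewrite ?ore_mulDl ?ore_mul0l.
Qed.

Lemma ore_mulCl a p q : oM (a%:P * p) q = a%:P * oM p q.
Proof.
have le : (size (a%:P * p)%R <= size p)%N by rewrite mul_polyC size_scale_leq.
rewrite (ore_mulE _ le) mulr_sumr; apply: eq_bigr => i _.
by rewrite coefCM polyCM mulrA.
Qed.

Lemma ore_mulC a q : oM a%:P q = a%:P * q.
Proof.
rewrite (@ore_mulE 1) ?size_polyC_leq1 // big_ord1 /=.
by rewrite coefC.
Qed.

(** Both sides split into a [sigma] part, shifted by one degree, and a [delta] part, by the rule X a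
    = sigma(a) X + delta(a). *)
Lemma ore_mul_X p q : oM (oX p) q = oX (oM p q).
Proof.
have le : (size (oX p) <= (size p).+1)%N.
  apply/leq_sizeP => -[|i] // ip; rewrite coef_oreX.
  rewrite !nth_default ?(klinear0 sigmaK) ?(klinear0 deltaK) ?addr0 //.
  exact: ltnW.
rewrite (ore_mulE _ le) (big_morph oX oreXD oreX0).
under [LHS]eq_bigr do rewrite coef_oreX polyCD mulrDl.
under [RHS]eq_bigr do rewrite oreX_polyC.
rewrite !big_split /=; congr (_ + _).
  (* The shift leaves 0 in degree 0; in the [delta] part the surplus top coefficient is
     [delta 0]. *)
  by rewrite big_ord_recl /= mul0r add0r.
by rewrite big_ord_recr /= nth_default // (klinear0 deltaK) mul0r addr0.
Qed.

(** Left linearity over A reduces the claim to the left factors X^i, then to X alone by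
    iteration. *)
Lemma ore_mulA : associative oM.
Proof.
move=> p q r; rewrite [oM p q]/ore_mul ore_mul_suml; apply: eq_bigr => i _.
rewrite ore_mulCl; congr (_ * _); elim: (nat_of_ord i) => //= m ->.
by rewrite ore_mul_X.
Qed.

Lemma ore_mul1l : left_id 1 oM.
Proof. by move=> q; rewrite -[1]/(1%:P) ore_mulC mul1r. Qed.

Lemma ore_mul1r : right_id 1 oM.
Proof.
move=> p; rewrite /ore_mul -[RHS]coefK poly_def; apply: eq_bigr => i _.
by rewrite iter_oreX1 mul_polyC.
Qed.

Lemma coef_scT (c : K) (p : {poly A}) i : (scT c p)`_i = c *: p`_i.
Proof. by rewrite coef_map_id0 // scaler0. Qed.

Lemma scTE (c : K) (p : {poly A}) : scT c p = (c%:A)%:P * p.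
Proof. by apply/polyP => i; rewrite coef_scT coefCM -scalerAl mul1r. Qed.

Lemma scT_mull (c : K) p q : scT c (oM p q) = oM (scT c p) q.
Proof. by rewrite !scTE ore_mulCl. Qed.

Lemma scT_mulr (c : K) p q : scT c (oM p q) = oM p (scT c q).
Proof.
rewrite !scTE mulr_sumr; apply: eq_bigr => i _.
rewrite iter_oreX_fixed ?(klinearZ sigmaK) ?(klinearZ deltaK) ?sigma1
  ?sigma_derivation1 ?scaler0 //.
by rewrite !mulrA -!polyCM -scalerAl -scalerAr mul1r mulr1.
Qed.

(** Such a constant commutes with X, and with coefficients because it is central in A. *)
Lemma ore_central a : central a -> sigma a = a -> delta a = 0 ->
  gcentral oM a%:P.
Proof.
move=> ac sa da q; rewrite ore_mulC -[in LHS](ore_mul1r q) -[a%:P in RHS]mulr1.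
rewrite mulr_sumr; apply: eq_bigr => i _.
by rewrite iter_oreX_fixed // !mulrA -!polyCM ac.
Qed.

End OreTheory.

(** A separate name for [{poly A}], so that the twisted product does not clash with the ordinary
    polynomial product. *)
Definition ore_alg (K : fieldType) (A : algType K) (sigma delta : A -> A)
  (sigmaP : alg_map sigma) (deltaP : sigma_derivation sigma delta) : Type :=
  {poly A}.

Section OreAlg.
Context {K : fieldType} {A : algType K} {sigma delta : A -> A}.
Variables (sigmaP : alg_map sigma) (deltaP : sigma_derivation sigma delta).
Local Notation T := (ore_alg sigmaP deltaP).

HB.instance Definition _ := GRing.Zmodule.copy T {poly A}.

Let one_neq0 : (1 : {poly A}) != 0 :> T. Proof. exact: oner_neq0. Qed.

HB.instance Definition _ := GRing.Zmodule_isNzRing.Build T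
  (ore_mulA sigmaP deltaP) (@ore_mul1l _ _ sigma delta) (ore_mul1r sigmaP deltaP)
  (@ore_mulDl _ _ sigma delta) (ore_mulDr sigmaP deltaP) one_neq0.

Let scTA (a b : K) (p : T) : scT a (scT b p) = scT (a * b) p :> T.
Proof. by apply/polyP => i; rewrite !coef_scT scalerA. Qed.

Let scT1 : left_id 1 (@scT K A : K -> T -> T).
Proof. by move=> p; apply/polyP => i; rewrite coef_scT scale1r. Qed.

Let scTDr : right_distributive (@scT K A : K -> T -> T) +%R.
Proof.
by move=> c p q; apply/polyP => i; rewrite coefD !coef_scT coefD scalerDr.
Qed.

Let scTDl (p : T) : {morph (@scT K A)^~ p : a b / a + b >-> (a + b : T)}.
Proof.
by move=> a b; apply/polyP => i; rewrite coefD !coef_scT scalerDl.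
Qed.

HB.instance Definition _ :=
  GRing.Zmodule_isLmodule.Build K T scTA scT1 scTDr scTDl.

HB.instance Definition _ :=
  GRing.Lmodule_isLalgebra.Build K T (@scT_mull _ _ sigma delta).

HB.instance Definition _ :=
  GRing.Lalgebra_isAlgebra.Build K T (scT_mulr sigmaP deltaP).

(** * The coaction on the Ore extension *)

Context {n : nat} {H : hopf_data K n} {rho : 'I_n -> A -> A}.
Hypotheses (rhoP : comodule_algebra H rho).
Hypotheses (rho_sigma : comodule_morph rho sigma).
Hypotheses (rho_delta : comodule_morph rho delta).

Let rhoK i : klinear (rho i). Proof. by case: rhoP. Qed.

Lemma coef_rhoT i (p : {poly A}) k : (rhoT rho i p)`_k = rho i p`_k.
Proof. by rewrite coef_map_id0 // klinear0. Qed.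

Lemma rhoT_polyC i a : rhoT rho i a%:P = (rho i a)%:P.
Proof.
apply/polyP => k; rewrite coef_rhoT !coefC.
by case: eqP => // _; rewrite klinear0.
Qed.

Lemma rhoT_oreX i q :
  rhoT rho i (oreX sigma delta q) = oreX sigma delta (rhoT rho i q).
Proof.
apply/polyP => k; rewrite coef_rhoT !(coef_oreX sigmaP deltaP) klinearD //.
rewrite rho_delta coef_rhoT.
by case: k => [|k]; rewrite ?klinear0 // rho_sigma coef_rhoT.
Qed.

Lemma rhoT_iter i m q : rhoT rho i (iter m (oreX sigma delta) q) =
  iter m (oreX sigma delta) (rhoT rho i q).
Proof. by elim: m => //= m <-; rewrite rhoT_oreX. Qed.

(** The linear axioms hold coefficientwise. For products, the coaction commutes with left
    multiplication by X because it commutes with [sigma] and [delta], which leaves multiplicativity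
    of [rho] on coefficients. *)
Lemma rhoT_comodule_algebra : comodule_algebra (A := T) H (rhoT rho).
Proof.
have [_ [rr [rc [rM r1]]]] := rhoP.
have coef_sum (I : finType) (F : I -> T) k :
    ((\sum_i F i : T) : {poly A})`_k = \sum_i (F i : {poly A})`_k.
  exact: coef_sum.
have coefZ (c : K) (p : T) k : ((c *: p : T) : {poly A})`_k = c *: (p : {poly A})`_k.
  exact: coef_scT.
have rhoTD i (p q : T) : rhoT rho i (p + q) = rhoT rho i p + rhoT rho i q :> T.
  by apply/polyP => k; rewrite coefD !coef_rhoT coefD klinearD.
split=> [i c p q|].
  apply/polyP => k; rewrite coefD coef_rhoT coefD !coefZ coef_rhoT.
  by rewrite rhoK coef_rhoT.
split=> [p i j|].
  apply/polyP => k; rewrite coef_sum !coef_rhoT rr; apply: eq_bigr => l _.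
  by rewrite coefZ coef_rhoT.
split=> [p|].
  apply/polyP => k; rewrite coef_sum -[RHS]rc; apply: eq_bigr => l _.
  by rewrite coefZ coef_rhoT.
split=> [p q k|k]; last first.
  by rewrite -[1]/(1%:P) rhoT_polyC r1; apply/polyP => l; rewrite coefZ !coefC;
     case: eqP => // _; rewrite scaler0.
have rhoT0 : rhoT rho k 0 = 0 :> T.
  by apply/polyP => l; rewrite coef_rhoT coef0 klinear0.
have pE i j : (rhoT rho i p : T) * rhoT rho j q =
    \sum_(m < size p) (rho i p`_m)%:P * rhoT rho j (iter m (oreX sigma delta) q).
  have le : (size (rhoT rho i p) <= size p)%N.
    by apply/leq_sizeP => m pm; rewrite coef_rhoT nth_default // klinear0.
  transitivity (ore_mul sigma delta (rhoT rho i p) (rhoT rho j q)) => //.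
  rewrite (ore_mulE _ le); apply: eq_bigr => m _.
  by rewrite coef_rhoT rhoT_iter.
under eq_bigr do under eq_bigr do rewrite pE scaler_sumr.
under eq_bigr do rewrite exchange_big /=.
rewrite exchange_big /=.
rewrite (big_morph (rhoT rho k : T -> T) (rhoTD k) rhoT0); apply: eq_bigr => m _.
apply/polyP => l; rewrite coef_rhoT coefCM rM coef_sum; apply: eq_bigr => i _.
rewrite coef_sum; apply: eq_bigr => j _.
by rewrite coefZ coefCM coef_rhoT.
Qed.

End OreAlg.

Lemma fixed_central_subalgebra (K : fieldType) (n : nat) (H : hopf_data K n)
    (A : algType K) (rho : 'I_n -> A -> A) (sigma delta : A -> A) :
  is_hopf H -> hopf_commutative H -> comodule_algebra H rho ->
  alg_map sigma -> sigma_derivation sigma delta ->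
  comodule_morph rho sigma -> comodule_morph rho delta ->
  comodule_subalgebra rho (fun a => sigma a = a /\ delta a = 0 /\ central a).
Proof.
move=> hH hC rhoP sigmaP deltaP rho_sigma rho_delta.
have [[c1 [cD [cZ cM]]] crho] := central_subalgebra hH hC rhoP.
have [sigmaK [sigmaM sigma1]] := sigmaP; have [deltaK deltaM] := deltaP.
have rhoK i : klinear (rho i) by case: rhoP.
split; last first.
  move=> a i [sa [da ac]]; rewrite -rho_sigma -rho_delta sa da klinear0 //.
  by split=> //; split=> //; exact: crho.
split; first by rewrite sigma1 (sigma_derivation1 sigmaP deltaP).
split=> [a b [sa [da ac]] [sb [db bc]]|].
  rewrite !klinearD // sa sb da db addr0.
  by split=> //; split=> //; exact: cD.
split=> [c a [sa [da ac]]|a b [sa [da ac]] [sb [db bc]]].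
  rewrite !klinearZ // sa da scaler0.
  by split=> //; split=> //; exact: cZ.
rewrite sigmaM deltaM sa sb da db mulr0 mul0r addr0.
by split=> //; split=> //; exact: cM.
Qed.

Unset Implicit Arguments.

Theorem theorem3p17 (K : fieldType) (n : nat) (H : hopf_data K n)
  (A : algType K) (rho : 'I_n -> A -> A) (sigma delta : A -> A) :
  [pchar K] =i pred0 ->
  is_hopf H -> hopf_commutative H ->
  comodule_algebra H rho ->
  alg_map sigma -> sigma_derivation sigma delta ->
  comodule_morph rho sigma -> comodule_morph rho delta ->
  (* (1) *)
  (comodule_subalgebra rho (@central K A) /\
   comodule_subalgebra rho
     (fun a => sigma a = a /\ delta a = 0 /\ central a) /\
   (forall a, ((sigma a = a /\ delta a = 0 /\ central a) /\ coinv H rho a) <->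
              ((coinv H rho a /\ sigma a = a) /\ (coinv H rho a /\ delta a = 0)
               /\ central a))) /\
  (* (2) *)
  (galois_ext *%R rho
     (fun a => sigma a = a /\ delta a = 0 /\ central a)
     (fun a => (coinv H rho a /\ sigma a = a) /\ (coinv H rho a /\ delta a = 0)
               /\ central a) ->
   centrally_galois H (ore_mul sigma delta) 1 (rhoT rho) (@scT K A)).
Proof.
move=> char0 hH hC rhoP sigmaP deltaP rho_sigma rho_delta.
have fixedP := fixed_central_subalgebra hH hC rhoP sigmaP deltaP
  rho_sigma rho_delta.
split.
  split; first exact: (central_subalgebra hH hC rhoP).
  by split=> // a; tauto.
move=> [_ surj].
have rhoTP := rhoT_comodule_algebra sigmaP deltaP rhoP rho_sigma rho_delta.
apply: (centrally_galois_criterion char0 hH hC rhoTP) => x.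
(* The target 1 (x) x lies over the fixed central subalgebra, which contains the scalars. *)
have [|s [sC sE]] := surj (fun i => x i *: 1).
  by move=> i; have [[f1 [_ [fZ _]]] _] := fixedP; exact: fZ.
exists [seq (p.1%:P, p.2%:P) | p <- s]; split=> [p /mapP [q qs ->] /=|i].
  have [[s1 [d1 c1]] [s2 [d2 c2]]] := sC _ qs.
  by split; apply: (ore_central sigmaP deltaP).
rewrite /galois_map big_map /=.
(* On constants the Ore product and coaction are those of A, so the Galois image is computed in
   A. *)
transitivity ((\sum_(p <- s) p.1 * rho i p.2)%:P : ore_alg sigmaP deltaP).
  rewrite (big_morph (@polyC A) (@polyCD A) (@polyC0 A)).
  apply: eq_bigr => p _; rewrite [LHS](@ore_mulC _ _ sigma delta).
  by rewrite (rhoT_polyC rhoP) polyCM.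
have := sE i; rewrite /galois_map => ->.
apply/polyP => k; rewrite [RHS]coef_scT !coefC.
by case: eqP => // _; rewrite scaler0.
Qed.
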